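(* Let $I\subset(0,1)$ be a closed interval and suppose $f:I\to[0,1]$ has a simulation on $I$ such that the number of inputs needed $N$ satisfies $\sup_{p\in I}\mathbf{E}_p(N)<\infty$. Then $f$ is Lipschitz over $I$.
   Context: For $p\in[0,1]$ let $\mathbf{P}_p$ (with expectation $\mathbf{E}_p$) be the law of an infinite sequence $X_1,X_2,\ldots$ of i.i.d. $\{0,1\}$-valued random variables (''$p$-coin tosses'') with $\mathbf{P}_p(X_i=1)=p$. An algorithm consists of a stopping time $N$ (values in $\{0,1,2,\ldots\}\cup\{\infty\}$) with respect to the natural filtration of $(X_i)_{i\ge1}$, and a $\{0,1\}$-valued output which, on $\{N<\infty\}$, is a function of $(X_1,\ldots,X_N)$ only; no randomness other than the tosses is used, and the algorithm does not depend on $p$. $N$ is the number of inputs needed. The algorithm simulates a function $f:S\to[0,1]$ on $S\subset[0,1]$ (is a simulation of $f$ on $S$) if for every $p\in S$ we have $\mathbf{P}_p(N<\infty)=1$ and $\mathbf{P}_p(\text{output}=1)=f(p)$. *)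

(* Defs.v *)
From HB Require Import structures.
From mathcomp Require Import all_boot all_order all_algebra.
From mathcomp Require Import finmap.
From mathcomp Require Import all_classical all_reals all_analysis.

Set Implicit Arguments.
Unset Strict Implicit.
Unset Printing Implicit Defensive.

Import Order.TTheory GRing.Theory Num.Theory.
Import numFieldNormedType.Exports.

Local Open Scope classical_set_scope.
Local Open Scope ring_scope.
Local Open Scope ereal_scope.

Definition mutually_independent d (T : measurableType d) (R : realType)
    (P : probability T R) d' (T' : measurableType d') (X : nat -> T -> T') :=
  forall (J : {fset nat}) (B : nat -> set T'),
    (forall i, measurable (B i)) ->
    P (\bigcap_(i in [set` J]) X i @^-1` B i) =
    \prod_(i <- J) P (X i @^-1` B i).

(* The tosses are numbered from 0: [X i] is the (i+1)-st toss. *)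
Definition iid_coin_tosses d (T : measurableType d) (R : realType)
    (X : nat -> {mfun T >-> bool}) (p : R) (P : probability T R) :=
  mutually_independent P (fun i => X i : T -> bool) /\
  forall i, P [set w | X i w] = p%:E.

(* The sigma-algebra generated by the first n tosses. *)
Definition natural_filtration d (T : measurableType d)
    (X : nat -> {mfun T >-> bool}) (n : nat) : set (set T) :=
  <<s \bigcup_(i in `I_n) preimage_set_system setT (X i) measurable >>.

(* Times take values in the naturals extended with infinity, encoded as [None]. *)
Definition is_stopping_time (T : Type) (F : nat -> set (set T))
    (N : T -> option nat) :=
  forall n, F n [set w | exists2 m, N w = Some m & (m <= n)%N].

Definition time_ereal (R : realType) (t : option nat) : \bar R :=
  if t is Some n then n%:R%:E else +oo.

(* What [output] does where [inputs] is infinite is left free, apart from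
   measurability, so that the probability that [output] is 1 makes sense. *)
Record algorithm d (T : measurableType d) (X : nat -> {mfun T >-> bool}) :=
  Algorithm {
    inputs : T -> option nat ;
    output : {mfun T >-> bool} ;
    inputs_stopping_time : is_stopping_time (natural_filtration X) inputs ;
    output_fun_of_inputs : exists g : seq bool -> bool, forall w n,
      inputs w = Some n -> output w = g (mkseq (fun i => X i w) n)
  }.

(* [T], [X] and hence the algorithm are common to all p; only the law [P p]
   depends on p. *)
Definition simulates d (T : measurableType d) (R : realType)
    (X : nat -> {mfun T >-> bool}) (P : R -> probability T R)
    (A : algorithm X) (S : set R) (f : R -> R) :=
  forall p, S p ->
    P p [set w | inputs A w <> None] = 1 /\
    P p [set w | output A w] = (f p)%:E.

Definition expected_inputs d (T : measurableType d) (R : realType)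
    (X : nat -> {mfun T >-> bool}) (P : probability T R) (A : algorithm X) :
    \bar R :=
  \int[P]_w time_ereal R (inputs A w).

(* Main.v *)
Require Import Defs.
From HB Require Import structures.
From mathcomp Require Import all_boot all_order all_algebra.
From mathcomp Require Import finmap.
From mathcomp Require Import all_classical all_reals all_analysis.
From mathcomp Require Import measurable_realfun.
From mathcomp Require Import ring lra.

Set Implicit Arguments.
Unset Strict Implicit.
Unset Printing Implicit Defensive.

Import Order.TTheory GRing.Theory Num.Theory.
Import numFieldNormedType.Exports.

Local Open Scope classical_set_scope.
Local Open Scope ring_scope.

(** Once the tosses seen by the algorithm are fixed to be a word [s] with [k]
    heads and [l] tails, its probability [p ^ k * (1 - p) ^ l] has logarithmic
    derivative [k / p - l / (1 - p)], which on a compact part of (0, 1) is, in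
    absolute value, at most a constant [C] times the length [k + l].  Hence the derivative of
    P_p(N = m, output = 1), a finite sum of such monomials over words of length
    [m], has absolute value at most [C * m * P_p(N = m, output = 1)]
    ([norm_deriv_event_poly]).  Summing over [m < n], the polynomial
    P_p(N < n, output = 1) has derivative bounded by [C * E_p(N)]
    ([partial_expectation_le]), a bound uniform in [n] and in [p] in the
    interval.  These polynomials are therefore Lipschitz with one constant, and
    they converge pointwise to P_p(output = 1) = f p because N is almost surely
    finite ([cvg_output_law]); the Lipschitz bound passes to the limit.

    Grouping the outcomes by the halting time, instead of expanding everything
    at the common horizon [n], is what makes the expectation of N appear: at a
    common horizon the same estimate would only give the factor [n].

    The passage from probabilities to polynomials rests on the fact that the
    events N = m and (N = m, output = 1) depend only on the first [m] tosses
    ([natural_filtration_determined]), so that they are finite disjoint unions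
    of cylinders, whose laws are given by independence ([determined_law]). *)

(** * Probabilities of words as polynomials in the bias *)

Definition toss_poly (R : nzRingType) (b : bool) : {poly R} :=
  if b then 'X else 1 - 'X.

Definition word_poly (R : nzRingType) (s : seq bool) : {poly R} :=
  \prod_(b <- s) toss_poly R b.

Lemma toss_poly_ge0 (R : numDomainType) (b : bool) (p : R) :
  0 <= p <= 1 -> 0 <= (toss_poly R b).[p].
Proof.
by move=> /andP[p0 p1]; case: b; rewrite /toss_poly !hornerE // subr_ge0.
Qed.

Lemma word_poly_ge0 (R : numDomainType) (s : seq bool) (p : R) :
  0 <= p <= 1 -> 0 <= (word_poly R s).[p].
Proof.
move=> p01; rewrite /word_poly horner_prod; apply: prodr_ge0 => b _.
exact: toss_poly_ge0.
Qed.

Lemma norm_deriv_toss_poly (R : numDomainType) (b : bool) (p : R) :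
  `|(toss_poly R b)^`().[p]| = 1.
Proof.
by case: b; rewrite /toss_poly ?derivB -?polyC1 ?derivC derivX ?sub0r hornerE
  ?hornerE ?normrN normr1.
Qed.

(** By induction on the word: the derivative of each factor is [1] or [-1],
    hence at most [C] times the factor itself, and the product rule adds up one
    such contribution per letter. *)
Lemma norm_deriv_word_poly (R : numDomainType) (C p : R) (s : seq bool) :
  0 <= p <= 1 -> (forall b, 1 <= C * (toss_poly R b).[p]) ->
  `|(word_poly R s)^`().[p]| <= C * (size s)%:R * (word_poly R s).[p].
Proof.
move=> p01 C1; elim: s => [|b s IHs].
  by rewrite /word_poly big_nil -polyC1 derivC horner0 normr0 mulr0 mul0r.
have -> : word_poly R (b :: s) = toss_poly R b * word_poly R s.
  by rewrite /word_poly big_cons.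
rewrite derivM hornerD !hornerM; apply: (le_trans (ler_normD _ _)).
rewrite !normrM norm_deriv_toss_poly mul1r.
have L0 := toss_poly_ge0 b p01; have W0 := word_poly_ge0 s p01.
rewrite (ger0_norm L0) (ger0_norm W0) /= -natr1.
set L := (toss_poly R b).[p] in L0 *; set W := (word_poly R s).[p] in W0 IHs *.
have -> : C * ((size s)%:R + 1) * (L * W) =
  C * L * W + L * (C * (size s)%:R * W) by ring.
apply: lerD; last exact: ler_wpM2l.
by rewrite -[leLHS]mul1r; apply: ler_wpM2r; last exact: C1.
Qed.

Lemma poly_lipschitz_of_deriv (R : realType) (F : {poly R}) (a b K : R) :
  (forall c, c \in `[a, b] -> `|F^`().[c]| <= K) ->
  {in `[a, b] &, forall x y, `|F.[x] - F.[y]| <= K * `|x - y|}.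
Proof.
move=> FK x y xab yab; wlog xy : x y xab yab / x <= y => [hw|].
  have [xy|/ltW yx] := leP x y; first exact: hw.
  by rewrite distrC (distrC x); apply: hw.
rewrite distrC (distrC x).
have dF c : c \in `]x, y[ -> is_derive c 1 (horner F) F^`().[c].
  by move=> _; apply: is_derive_poly.
have cF : {within `[x, y], continuous (horner F)}.
  by apply: derivable_within_continuous => c _; apply: derivable_horner.
have [c cxy ->] := MVT_segment xy dF cF.
rewrite normrM ler_wpM2r // FK //.
move: xab yab cxy; rewrite !in_itv /= => /andP[ax _] /andP[_ yb] /andP[xc cy].
by rewrite (le_trans ax xc) (le_trans cy yb).
Qed.

(** * Events determined by finitely many tosses *)

Definition tosses (T : Type) (X : nat -> T -> bool) (n : nat) (w : T) :=
  mkseq (X^~ w) n.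

Definition determined_by_tosses (T : Type) (X : nat -> T -> bool) (n : nat)
    (B : set T) :=
  forall w w', tosses X n w = tosses X n w' -> B w -> B w'.

(** When [B] is determined by the first [n] tosses, this is the law of [B] as a
    function of the bias: one monomial for each word that is realised in [B]. *)
Definition event_poly (R : nzRingType) (T : Type) (X : nat -> T -> bool)
    (n : nat) (B : set T) : {poly R} :=
  \sum_(t : n.-tuple bool | `[< exists2 w, B w & tosses X n w = t >])
    word_poly R t.

Lemma tossesP (T : Type) (X : nat -> T -> bool) (s : seq bool) (w : T) :
  tosses X (size s) w = s <->
  forall i, (i < size s)%N -> X i w = nth false s i.
Proof.
split=> [<- i|Xs]; first by rewrite size_mkseq => i_s; rewrite nth_mkseq.
apply: (@eq_from_nth _ false); rewrite size_mkseq // => i i_s.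
by rewrite nth_mkseq ?Xs.
Qed.

(** The events determined by the first [n] tosses form a sigma-algebra which
    contains the generators of the filtration, so it contains the filtration. *)
Lemma natural_filtration_determined d (T : measurableType d)
    (X : nat -> {mfun T >-> bool}) (n : nat) (B : set T) :
  natural_filtration X n B ->
  determined_by_tosses (fun i => X i : T -> bool) n B.
Proof.
apply: (@smallest_sub _ (sigma_algebra setT) _
  (fun B => determined_by_tosses (fun i => X i : T -> bool) n B)).
  split=> [w w' _ //|D detD w w' ww'|F detF w w' ww' [k _ Fkw]].
  - by rewrite !setTD => nDw /(detD _ _ (esym ww')).
  - by exists k => //; apply: detF ww' Fkw.
move=> D [i /= i_n [Y _ <-]] w w' ww'; rewrite setTI /=.
suff -> : X i w = X i w' by [].
have := congr1 (fun s => nth false s i) ww'.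
by rewrite !nth_mkseq.
Qed.

Lemma coin_toss_law d (T : measurableType d) (R : realType)
    (X : nat -> {mfun T >-> bool}) (p : R) (P : probability T R) :
  iid_coin_tosses X p P ->
  forall i b, P (X i @^-1` [set b]) = (toss_poly R b).[p]%:E.
Proof.
move=> [_ Xp] i; have XpE : P (X i @^-1` [set true]) = p%:E.
  by rewrite -(Xp i); congr (P _); apply/seteqP; split => w /=.
case; first by rewrite XpE /= hornerX.
have -> : X i @^-1` [set false] = ~` (X i @^-1` [set true]).
  by apply/seteqP; split => w /=; case: (X i w).
rewrite probability_setC ?XpE ?hornerE //=.
by rewrite -[X in measurable X]setTI; apply: measurable_funP.
Qed.

Lemma measurable_cylinder d (T : measurableType d)
    (X : nat -> {mfun T >-> bool}) (s : seq bool) :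
  measurable [set w | tosses (fun i => X i : T -> bool) (size s) w = s].
Proof.
have -> : [set w | tosses (fun i => X i : T -> bool) (size s) w = s] =
    \bigcap_(i in `I_(size s)) (X i @^-1` [set nth false s i]).
  apply/seteqP; split => w /= => [/tossesP //|Xs].
  by apply/tossesP => i /Xs.
apply: bigcap_measurableType => i _.
by rewrite -[X in measurable X]setTI; apply: measurable_funP.
Qed.

Lemma cylinder_law d (T : measurableType d) (R : realType)
    (X : nat -> {mfun T >-> bool}) (p : R) (P : probability T R)
    (s : seq bool) :
  iid_coin_tosses X p P ->
  P [set w | tosses (fun i => X i : T -> bool) (size s) w = s] =
  (word_poly R s).[p]%:E.
Proof.
move=> iidX; have [indX _] := iidX.
pose J := seq_fset tt (iota 0 (size s)).
have -> : [set w | tosses (fun i => X i : T -> bool) (size s) w = s] =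
    \bigcap_(i in [set` J]) (X i @^-1` [set nth false s i]).
  apply/seteqP; split => w /=.
    move=> /tossesP Xs i /=; rewrite /J seq_fsetE mem_iota add0n; exact: Xs.
  move=> Xs; apply/tossesP => i i_s; apply: Xs => /=.
  by rewrite /J seq_fsetE mem_iota.
rewrite (indX J (fun i => [set nth false s i])) //.
under eq_bigr => i _ do rewrite (coin_toss_law iidX).
rewrite prodEFin /word_poly horner_prod (big_nth false) /index_iota subn0.
congr EFin; apply: perm_big.
apply: uniq_perm; rewrite ?fset_uniq ?iota_uniq // => i.
by rewrite seq_fsetE.
Qed.

(** As there are only finitely many words of length [n], this finite
    decomposition gives both measurability and the law of [B]. *)
Lemma determined_cylinders d (T : measurableType d)
    (X : nat -> {mfun T >-> bool}) (n : nat) (B : set T) :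
  determined_by_tosses (fun i => X i : T -> bool) n B ->
  B = \bigcup_(t in [set t : n.-tuple bool | exists2 w, B w &
         tosses (fun i => X i : T -> bool) n w = t])
      [set w | tosses (fun i => X i : T -> bool) (size t) w = t].
Proof.
move=> detB; apply/seteqP; split => w.
  move=> Bw; exists (Tuple (introT eqP (size_mkseq (X^~ w) n))).
    by exists w.
  by rewrite /= size_mkseq.
by move=> [t [w' Bw' w't]] /=; rewrite size_tuple -w't => /esym /detB; apply.
Qed.

Lemma measurable_determined d (T : measurableType d)
    (X : nat -> {mfun T >-> bool}) (n : nat) (B : set T) :
  determined_by_tosses (fun i => X i : T -> bool) n B -> measurable B.
Proof.
move=> detB; rewrite (determined_cylinders detB).
by apply: fin_bigcup_measurable => // t _; apply: measurable_cylinder.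
Qed.

Lemma determined_law d (T : measurableType d) (R : realType)
    (X : nat -> {mfun T >-> bool}) (p : R) (P : probability T R) (n : nat)
    (B : set T) :
  iid_coin_tosses X p P ->
  determined_by_tosses (fun i => X i : T -> bool) n B ->
  P B = (event_poly R (fun i => X i : T -> bool) n B).[p]%:E.
Proof.
move=> iidX detB; rewrite {1}(determined_cylinders detB).
pose Q (t : n.-tuple bool) := `[< exists2 w, B w &
  tosses (fun i => X i : T -> bool) n w = t >].
have -> : [set t : n.-tuple bool | exists2 w, B w &
    tosses (fun i => X i : T -> bool) n w = t] = [set` Q].
  by apply/seteqP; split => t /= /asboolP.
rewrite measure_fin_bigcup //; first last.
- by move=> t _; apply: measurable_cylinder.
- move=> t t' _ _ [w [/= wt wt']]; apply: val_inj => /=.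
  by rewrite -wt -wt' !size_tuple.
rewrite /event_poly horner_sum -sumEFin.
rewrite [RHS]bigfs ?index_enum_uniq // => [|t _]; last first.
  by rewrite mem_index_enum.
by apply: eq_fsbigr => t _; exact: cylinder_law.
Qed.

Lemma norm_deriv_event_poly (R : numDomainType) (T : Type)
    (X : nat -> T -> bool) (C p : R) (n : nat) (B : set T) :
  0 <= p <= 1 -> (forall b, 1 <= C * (toss_poly R b).[p]) ->
  `|(event_poly R X n B)^`().[p]| <= C * (n%:R * (event_poly R X n B).[p]).
Proof.
move=> p01 C1; rewrite /event_poly raddf_sum !horner_sum.
apply: (le_trans (ler_norm_sum _ _ _)); rewrite !mulr_sumr.
apply: ler_sum => t _; rewrite mulrA.
by apply: (le_trans (norm_deriv_word_poly t p01 C1)); rewrite size_tuple.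
Qed.

(** * Halting events of an algorithm *)

Lemma halting_determined d (T : measurableType d)
    (X : nat -> {mfun T >-> bool}) (A : algorithm X) (n : nat) :
  determined_by_tosses (fun i => X i : T -> bool) n
    [set w | inputs A w = Some n].
Proof.
have detN := natural_filtration_determined (@inputs_stopping_time _ _ _ A n).
move=> w w' ww' Nw.
have [|m Nw' m_n] := detN w w' ww' _; first by exists n.
case: (ltngtP m n) m_n => // [m_n|<-] _ //.
(* Stopping earlier on [w'] would be seen by the first [m] tosses of [w]. *)
have detM := natural_filtration_determined (@inputs_stopping_time _ _ _ A m).
have w'w : tosses (fun i => X i : T -> bool) m w' =
    tosses (fun i => X i : T -> bool) m w.
  have := congr1 (take m) (esym ww').
  by rewrite /tosses /mkseq -!map_take take_iota (minn_idPl (ltnW m_n)).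
have [|k] := detM w' w w'w _; first by exists m.
by rewrite Nw => -[<-]; rewrite leqNgt m_n.
Qed.

Definition halting_with_output_1 d (T : measurableType d)
    (X : nat -> {mfun T >-> bool}) (A : algorithm X) (n : nat) : set T :=
  [set w | inputs A w = Some n /\ output A w].

Lemma halting_with_output_1_determined d (T : measurableType d)
    (X : nat -> {mfun T >-> bool}) (A : algorithm X) (n : nat) :
  determined_by_tosses (fun i => X i : T -> bool) n (halting_with_output_1 A n).
Proof.
have [g outg] := output_fun_of_inputs A.
move=> w w' ww' [Nw ow]; have Nw' := halting_determined ww' Nw.
split=> //; move: ow; rewrite (outg _ _ Nw) (outg _ _ Nw').
by move: ww'; rewrite /tosses => ->.
Qed.

Lemma measurable_halting d (T : measurableType d)
    (X : nat -> {mfun T >-> bool}) (A : algorithm X) (n : nat) :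
  measurable [set w | inputs A w = Some n].
Proof. exact: measurable_determined (@halting_determined _ _ _ A n). Qed.

Lemma trivIset_halting d (T : measurableType d)
    (X : nat -> {mfun T >-> bool}) (A : algorithm X) :
  trivIset setT (fun n => [set w | inputs A w = Some n]).
Proof. by move=> m n _ _ [w [/= -> [->]]]. Qed.

(** The time N is constant on each event N = m, and these events are disjoint;
    the event N = oo, which can only increase the integral, is dropped. *)
Lemma partial_expectation_le d (T : measurableType d) (R : realType)
    (X : nat -> {mfun T >-> bool}) (P : probability T R) (A : algorithm X)
    (n : nat) :
  (\sum_(0 <= m < n) m%:R%:E * P [set w | inputs A w = Some m] <=
   expected_inputs P A)%E.
Proof.
pose tN : T -> \bar R := fun w => time_ereal R (inputs A w).
pose H m := [set w | inputs A w = Some m].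
have mH m : measurable (H m) by exact: measurable_halting.
have mUH : measurable (\bigcup_m H m) by exact: bigcup_measurable.
have mNH m : measurable_fun (H m) tN.
  apply: (@eq_measurable_fun _ _ _ _ _ (cst m%:R%:E)) => //.
  by move=> w; rewrite inE /H /tN /= => ->.
have mNU : measurable_fun (\bigcup_m H m) tN.
  exact/measurable_fun_bigcup.
have N_ge0 w : (0 <= tN w)%E.
  by rewrite /tN; case: (inputs A w) => [m|] /=; rewrite ?lee_fin ?leey.
(* Outside the events N = m, the time is constantly infinite. *)
have mN : measurable_fun setT tN.
  rewrite -(setUv (\bigcup_m H m)); apply/measurable_funU => //.
    exact: measurableC.
  split=> //; apply: (@eq_measurable_fun _ _ _ _ _ (cst +oo%E)) => // w.
  rewrite inE /tN /= => nH; case Nw: (inputs A w) => [m|//].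
  by exfalso; apply: nH; exists m.
rewrite /expected_inputs.
apply: (le_trans _ (ge0_subset_integral P mUH measurableT mN _ _)) => //.
rewrite ge0_integral_bigcup //; last exact: trivIset_halting.
apply: (le_trans _ (nneseries_lim_ge n _)); first last.
  by move=> m _ _; apply: integral_ge0.
apply: lee_sum => m _; rewrite -/(H m) -(integral_cst P (mH m)).
apply: ge0_le_integral => // w; first by rewrite lee_fin.
by rewrite /H /tN /= => ->.
Qed.

(** Since N is almost surely finite, the event that the output is 1 is, up to a
    null set, the disjoint union over [m] of its parts with N = m. *)
Lemma cvg_output_law d (T : measurableType d) (R : realType)
    (X : nat -> {mfun T >-> bool}) (P : probability T R) (A : algorithm X) :
  P [set w | inputs A w <> None] = 1%E ->
  (fun n => \sum_(0 <= m < n) P (halting_with_output_1 A m))%E @ \oo -->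
  P [set w | output A w].
Proof.
move=> Nfin.
have mB m : measurable (halting_with_output_1 A m).
  exact: measurable_determined (@halting_with_output_1_determined _ _ _ A m).
have -> : P [set w | output A w] = P (\bigcup_m halting_with_output_1 A m).
  have UHE : [set w | inputs A w <> None] =
      \bigcup_m [set w | inputs A w = Some m].
    apply/seteqP; split => w /=; last by case=> m _ /= ->.
    by case Nw: (inputs A w) => [m|//] _; exists m.
  have mU : measurable [set w | inputs A w <> None].
    rewrite UHE; apply: bigcup_measurable => m _; exact: measurable_halting.
  have mO : measurable [set w | output A w].
    have -> : [set w | output A w] = output A @^-1` [set true].
      by apply/seteqP; split => w /=.
    by rewrite -[X in measurable X]setTI; apply: measurable_funP.
  have nullN : P ([set w | output A w] `\` [set w | inputs A w <> None]) = 0%E.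
    apply/eqP; rewrite eq_le measure_ge0 andbT.
    rewrite (_ : 0%E = P (~` [set w | inputs A w <> None])).
      by apply: le_measure; rewrite ?inE; [exact: measurableD|exact: measurableC|
        move=> w []].
    by rewrite probability_setC // Nfin subee.
  rewrite (measureDI P mO mU) [X in (X + _)%E]nullN add0e UHE setI_bigcupr.
  congr (P _).
  by apply: eq_bigcupr => m _; apply/seteqP; split => w [].
apply: measure_semi_sigma_additive => //.
- by move=> m n _ _ [w [[/= Nm _] [/= ]]]; rewrite Nm => -[->].
- exact: bigcup_measurable.
Qed.

(** * The Lipschitz bound *)

Theorem proposition23 (R : realType) (d : measure_display)
    (T : measurableType d) (X : nat -> {mfun T >-> bool})
    (P : R -> probability T R)
    (coinP : forall p, 0 <= p <= 1 -> iid_coin_tosses X p (P p))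
    (a b : R) (a0 : 0 < a) (ab : a <= b) (b1 : b < 1)
    (f : R -> R) (f01 : forall p, p \in `[a, b] -> 0 <= f p <= 1)
    (simf : exists A : algorithm X,
      simulates P A `[a, b] f /\
      (ereal_sup [set expected_inputs (P p) A | p in `[a, b]] < +oo)%E) :
  [lipschitz f p | p in `[a, b]].
Proof.
have [A [simA supE]] := simf.
(* The supremum is nonnegative and less than +oo, so it is the image of a real number. *)
have [M EM] : exists M : R, forall p, p \in `[a, b] ->
    (expected_inputs (P p) A <= M%:E)%E.
  have E_ge0 : (0 <= ereal_sup [set expected_inputs (P p) A | p in `[a, b]])%E.
    apply: (@le_trans _ _ (expected_inputs (P a) A)).
      apply: integral_ge0 => w _.
      by case: (inputs A w) => [m|] /=; rewrite ?lee_fin ?leey.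
    by apply: ereal_sup_ubound; exists a => //=; rewrite in_itv /= lexx.
  exists (fine (ereal_sup [set expected_inputs (P p) A | p in `[a, b]])).
  move=> p pab; rewrite fineK ?ge0_fin_numE //.
  by apply: ereal_sup_ubound; exists p.
(* [1 / p] and [1 / (1 - p)] are at most [1 / a] and [1 / (1 - b)] on [a, b];
   the sum of these two bounds serves for both outcomes of a toss. *)
pose C := a^-1 + (1 - b)^-1.
have b1' : 0 < 1 - b by rewrite subr_gt0.
have C0 : 0 < C by rewrite addr_gt0 ?invr_gt0.
have itv01 p : p \in `[a, b] -> 0 <= p <= 1.
  by rewrite in_itv /= => /andP[ap pb]; apply/andP; split; lra.
have C1 p : p \in `[a, b] -> forall c, 1 <= C * (toss_poly R c).[p].
  rewrite in_itv /= => /andP[ap pb] c.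
  (* [m] is the least probability of the outcome [c] over the interval. *)
  have [m [m0 mC mL]] : exists m, [/\ 0 < m, m^-1 <= C &
      m <= (toss_poly R c).[p]].
    case: c; [exists a | exists (1 - b)]; split=> //.
    - by rewrite /C lerDl invr_ge0 ltW.
    - by rewrite hornerX.
    - by rewrite /C lerDr invr_ge0 ltW.
    - by rewrite /toss_poly !hornerE; lra.
  rewrite -(mulVf (lt0r_neq0 m0)); apply: ler_pM => //.
  - by rewrite invr_ge0 ltW.
  - exact: ltW.
pose Bpoly m := event_poly R (fun i => X i : T -> bool) m
  (halting_with_output_1 A m).
pose F n := \sum_(0 <= m < n) Bpoly m.
have BpolyE p m : p \in `[a, b] ->
    P p (halting_with_output_1 A m) = (Bpoly m).[p]%:E.
  move=> pab; apply: determined_law; first exact/coinP/itv01.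
  exact: halting_with_output_1_determined.
have FK n p : p \in `[a, b] -> `|(F n)^`().[p]| <= C * M.
  move=> pab; rewrite /F raddf_sum horner_sum.
  apply: (le_trans (ler_norm_sum _ _ _)).
  apply: (@le_trans _ _ (C * \sum_(0 <= m < n) m%:R * (Bpoly m).[p])).
    rewrite mulr_sumr; apply: ler_sum => m _.
    exact: norm_deriv_event_poly (itv01 _ pab) (C1 _ pab).
  rewrite ler_pM2l // -lee_fin -sumEFin.
  apply: (le_trans _ (EM p pab)).
  apply: (le_trans _ (partial_expectation_le (P p) A n)).
  apply: lee_sum => m _; rewrite EFinM -BpolyE //.
  apply: lee_wpmul2l; first by rewrite lee_fin.
  apply: le_measure; rewrite ?inE; last by move=> w [].
  - exact: measurable_determined (@halting_with_output_1_determined _ _ _ A m).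
  - exact: measurable_halting.
have Ff p : p \in `[a, b] -> (F n).[p] @[n --> \oo] --> f p.
  move=> pab; have [Nfin fp] := simA p pab.
  have := cvg_output_law Nfin; rewrite fp.
  under eq_fun => n do under eq_bigr => m _ do rewrite BpolyE //.
  under eq_fun => n do rewrite sumEFin -horner_sum.
  by move=> /fine_cvgP[].
apply: (@klipschitzW _ _ _ (C * M)) => [|[p q] [/= pab qab]].
  apply: (@globally_properfilter _ _ (a, a)).
  by split; rewrite /= in_itv /= lexx.
have Fpq : `|(F n).[p] - (F n).[q]| @[n --> \oo] --> `|f p - f q|.
  by apply: cvg_norm; apply: cvgB; exact: Ff.
apply: (cvgr_to_le Fpq); near=> n.
exact: (poly_lipschitz_of_deriv (FK n)).
Unshelve. all: by end_near. Qed.
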